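(* Assume that $f$ is invertible and that $f^{-1}$ and $h$ are continuous. Assume that there exist four non-negative constants $C_1,C_2,C_1',C_2'$ such that for all $x\in\mathbb{R}^n$, $$|x|\le C_1+C_2|f(x)|,\qquad |h(x)|\le C_1'+C_2'|x|.$$ Let $m$ be a positive integer, let $A\in\mathbb{R}^{m\times m}$ be a normal matrix with spectral radius $\rho(A)<\min\{1,1/C_2\}$, and let $B\in\mathbb{R}^{m\times p}$. For all $x\in\mathcal{X}$, set $$T(x)=\sum_{i=0}^{+\infty}A^iB\,h\big(f^{-(i+1)}(x)\big).$$ Then $T:\mathcal{X}\to\mathbb{R}^m$ is well defined, continuous, and satisfies $$T(f(x))=A\,T(x)+B\,h(x)\qquad\text{for all }x\in\mathcal{X},$$ where $T(f(x))$ denotes the value of the same series at the point $f(x)$.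
   Context: Let $n,p$ be positive integers, $f:\mathbb{R}^n\to\mathbb{R}^n$, $h:\mathbb{R}^n\to\mathbb{R}^p$, and let $\mathcal{X}\subset\mathbb{R}^n$. (In the setting considered, $\mathcal{X}$ contains a set $\mathcal{X}_0$ of initial conditions such that $f^k(x_0)\in\mathcal{X}$ for all $x_0\in\mathcal{X}_0$ and all integers $k\ge0$.) For a non-negative integer $i$, $f^i$ is the $i$-fold composition of $f$ with itself and $f^{-i}=(f^{-1})^i$. $|\cdot|$ is the Euclidean norm. By convention $1/C_2=+\infty$ if $C_2=0$. *)

(* Defs.v *)
From mathcomp Require Import all_boot all_order all_algebra.
From mathcomp Require Import complex.
From mathcomp Require Import all_classical all_reals all_analysis.

Set Implicit Arguments.
Unset Strict Implicit.
Unset Printing Implicit Defensive.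

Import Order.TTheory GRing.Theory Num.Theory.
Import numFieldNormedType.Exports.

Local Open Scope classical_set_scope.
Local Open Scope ring_scope.

(* The library norm on matrices is the maximum norm; it induces the same
   topology, but the growth bounds are stated for the Euclidean norm. *)
Definition enorm (R : realType) (n : nat) (x : 'cV[R]_n) : R :=
  Num.sqrt (\sum_(i < n) x i 0 ^+ 2).

(* Eigenvalues are taken in R[i].  For 0 < m they form a nonempty finite set,
   so that the supremum is a maximum. *)
Definition spectral_radius (R : realType) (m : nat) (A : 'M[R]_m) : R :=
  sup [set Normc.normc z | z in
         [set z : R[i] | eigenvalue (map_mx (real_complex R) A) z]].

Definition normal_mx (R : realType) (m : nat) (A : 'M[R]_m) : Prop :=
  A *m A^T = A^T *m A.

(* finv stands for the inverse of the dynamics, so iter i.+1 finv x is the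
   state i.+1 steps before x. *)
Definition T_term (R : realType) (n p m : nat) (finv : 'cV[R]_n -> 'cV[R]_n)
    (h : 'cV[R]_n -> 'cV[R]_p) (A : 'M[R]_m) (B : 'M[R]_(m, p))
    (x : 'cV[R]_n) (i : nat) : 'cV[R]_m :=
  A ^+ i *m B *m h (iter i.+1 finv x).

(* Meaningful only at points x where the series converges. *)
Definition T_map (R : realType) (n p m : nat) (finv : 'cV[R]_n -> 'cV[R]_n)
    (h : 'cV[R]_n -> 'cV[R]_p) (A : 'M[R]_m) (B : 'M[R]_(m, p))
    (x : 'cV[R]_n) : 'cV[R]_m :=
  limn (series (T_term finv h A B x)).

(* Main.v *)
From HB Require Import structures.
Require Import Defs.
From mathcomp Require Import all_boot all_order all_algebra.
From mathcomp Require Import complex ring lra spectral.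
From mathcomp Require Import all_classical all_reals all_analysis.

Set Implicit Arguments.
Unset Strict Implicit.
Unset Printing Implicit Defensive.

Import Order.TTheory GRing.Theory Num.Theory.
Import numFieldNormedType.Exports.

Local Open Scope classical_set_scope.
Local Open Scope ring_scope.

(** Write rho for the spectral radius of A.  The backward orbit of x can grow
    only geometrically: the bound on f, read at the preimage, says that
    |finv y| <= C1 + C2 |y|, so for every rate c >= 1 with c > C2 the iterates
    satisfy |finv^k x| <= (|x| + C1 / (c - C2)) c^k (iter_affine_growth).
    On the other side A^k decays like rho^k: a real normal matrix is unitarily
    diagonalizable over the complex numbers, its diagonal form has entries of
    modulus at most rho, and the change of basis costs only a constant factor
    (normal_mx_power_bound).  The hypothesis rho < min (1, 1 / C2) means exactly
    that rho max (1, C2) < 1, which leaves room for a rate c as above with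
    rho c < 1 (growth_rate_between).

    Hence the i-th term of the series is at most L (rho c)^i, where L depends
    only on a bound for |x| (T_term_geometric_bound).  The series is therefore
    dominated by a convergent geometric series near every point, and the
    Weierstrass M-test yields both convergence and continuity
    (dominated_series_cvg, locally_dominated_series_continuous).

    The functional equation is a shift of the index: at f x the first term is
    B h(x), and every later term is A times the previous term at x
    (series_T_termS).  The identity between partial sums passes to the limit
    because multiplication by A is continuous.

    The Euclidean norm measures the orbit and the growth of h; the series is
    estimated in the maximum norm, at the price of constant factors. *)

(** * Series dominated by a convergent numerical series *)

(* Matrices are both a normed module and a complete space; this joins the two
   structures. *)
HB.instance Definition _ (R : realType) m n :=
  Uniform_isComplete.Build 'M[R]_(m, n) (@mx_complete R m n).

Section WeierstrassMTest.
Context {R : realType} {T : topologicalType} {V : completeNormedModType R}.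

Lemma dominated_series_cvg (u : V ^nat) (a : R ^nat) :
  (forall i, `|u i| <= a i) -> cvgn (series a) -> cvgn (series u).
Proof.
move=> ua ca; apply: normed_cvg.
apply: (series_le_cvg _ _ _ ca) => i /=; [exact: normr_ge0| |exact: ua].
by apply: le_trans (ua i); exact: normr_ge0.
Qed.

(** The tail of the series is at most the tail of its majorant, a bound that
    does not see u: this is what makes the convergence uniform below. *)
Lemma dominated_series_tail (u : V ^nat) (a : R ^nat) N :
  (forall i, `|u i| <= a i) -> cvgn (series a) ->
  `|limn (series u) - series u N| <= limn (series a) - series a N.
Proof.
move=> ua ca; have cu := dominated_series_cvg ua ca.
have a_ge0 i : 0 <= a i by apply: le_trans (ua i); exact: normr_ge0.
have cd : (series u n - series u N) @[n --> \oo] -->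
    limn (series u) - series u N.
  by apply: cvgB => //; exact: cvg_cst.
rewrite -(cvg_lim (@norm_hausdorff _ R^o) (cvg_norm cd))//.
apply: limr_le; first by apply: is_cvg_norm; apply: cvgP cd.
near=> M.
have NM : (N <= M)%N by near: M; exact: nbhs_infty_ge.
rewrite sub_series_geq// (le_trans (ler_norm_sum _ _ _))//.
apply: le_trans (ler_sum _ (fun i _ => ua i)) _.
rewrite -sub_series_geq// lerB//.
apply: nondecreasing_cvgn_le => //; exact: nondecreasing_series.
Unshelve. all: by end_near. Qed.

(** Weierstrass M-test.  Continuity is local, so the majorant may depend on the
    point x, provided that it works for all y near x. *)
Lemma locally_dominated_series_continuous (u : nat -> T -> V) :
  (forall i, continuous (u i)) ->
  (forall x : T, exists2 a : R ^nat, cvgn (series a) &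
     \forall y \near x, forall i, `|u i y| <= a i) ->
  continuous (fun y => limn (series (u ^~ y))).
Proof.
move=> uc udom x; have [a ca xa] := udom x.
apply/cvgrPdist_lt => e e0.
have e30 : 0 < e / 3 by rewrite divr_gt0.
have /cvgrPdist_lt/(_ _ e30)[N _ /(_ N (leqnn N)) tailN] :
  series a n @[n --> \oo] --> limn (series a) by [].
have Sc M : continuous (fun y : T => series (u ^~ y) M).
  elim: M => [|M IH].
    rewrite (_ : (fun _ => _) = cst 0); first exact: cst_continuous.
    by apply/funext => y; rewrite /series /= big_geq.
  rewrite (_ : (fun _ => _) = (fun y => series (u ^~ y) M + u M y)).
    by move=> y; apply: cvgD; [exact: IH|exact: uc].
  by apply/funext => y; rewrite /series /= big_nat_recr.
have tail y : (forall i, `|u i y| <= a i) ->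
    `|limn (series (u ^~ y)) - series (u ^~ y) N| < e / 3.
  move=> ya; apply: le_lt_trans (dominated_series_tail _ ya ca) _.
  exact: le_lt_trans (ler_norm _) tailN.
near=> y.
have ya : forall i, `|u i y| <= a i by near: y.
have := tail y ya; rewrite distrC.
have := tail x (nbhs_singleton xa).
have : `|series (u ^~ x) N - series (u ^~ y) N| < e / 3.
  by near: y; move/cvgrPdist_lt : (Sc N x); exact.
move=> Sxy Tx Ty /=.
rewrite (_ : e = e / 3 + (e / 3 + e / 3)); last by field.
apply: le_lt_trans (ler_distD (series (u ^~ x) N) _ _) _; rewrite ltrD//.
by apply: le_lt_trans (ler_distD (series (u ^~ y) N) _ _) _; rewrite ltrD.
Unshelve. all: by end_near. Qed.

End WeierstrassMTest.

(** * Norm estimates *)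

Lemma mx_coord_le_norm {R : realType} m k (M : 'M[R]_(m, k)) i j :
  `|M i j| <= `|M|.
Proof.
rewrite [leRHS]/Num.norm /= mx_normrE.
exact: (le_bigmax _ (fun ij => `|M ij.1 ij.2|) (i, j)).
Qed.

Lemma mx_norm_le {R : realType} m k (M : 'M[R]_(m, k)) c :
  0 <= c -> (forall i j, `|M i j| <= c) -> `|M| <= c.
Proof.
move=> c0 Mc; rewrite [leLHS]/Num.norm /= mx_normrE.
by apply/bigmax_leP; split=> // -[i j] _; exact: Mc.
Qed.

Section EuclideanNorm.
Context {R : realType} {n : nat}.
Implicit Type x : 'cV[R]_n.

Lemma enorm_ge0 x : 0 <= enorm x.
Proof. exact: sqrtr_ge0. Qed.

Lemma norm_le_enorm x : `|x| <= enorm x.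
Proof.
apply: mx_norm_le (enorm_ge0 _) _ => i j; rewrite ord1 -sqrtr_sqr ler_wsqrtr//.
by rewrite (bigD1 i)//= lerDl sumr_ge0// => k _; exact: sqr_ge0.
Qed.

Lemma enorm_le_norm x : enorm x <= Num.sqrt n%:R * `|x|.
Proof.
rewrite -[X in _ * X]ger0_norm// -sqrtr_sqr -sqrtrM// ler_wsqrtr//.
rewrite mulr_natl -[X in _ *+ X]card_ord -sumr_const ler_sum// => i _.
by rewrite -[leLHS]real_normK ?num_real// lerXn2r ?nnegrE// mx_coord_le_norm.
Qed.

End EuclideanNorm.

Lemma mulmx_norm_le {R : realType} m k l (M : 'M[R]_(m, k)) (N : 'M[R]_(k, l)) :
  `|M *m N| <= k%:R * `|M| * `|N|.
Proof.
apply: mx_norm_le => [|i j]; first by rewrite !mulr_ge0.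
rewrite mxE (le_trans (ler_norm_sum _ _ _))// -mulrA mulr_natl.
rewrite -[X in _ *+ X]card_ord -sumr_const ler_sum// => s _.
by rewrite normrM ler_pM// mx_coord_le_norm.
Qed.

Lemma mulmx_continuous {R : realType} m k l (M : 'M[R]_(m, k)) :
  continuous (fun N : 'M[R]_(k, l) => M *m N).
Proof.
pose MM : {linear 'M[R]_(k, l) -> 'M[R]_(m, l)} := mulmx M.
apply/(linear_bounded_continuous MM)/linear_boundedP.
near=> r => N; apply: le_trans (mulmx_norm_le _ _) _.
by apply: ler_wpM2r => //; near: r; exact: nbhs_pinfty_ge.
Unshelve. all: by end_near. Qed.

(** Iterating the affine bound N (g y) <= C1 + C2 N y at the rate C2
    itself fails when C2 = 1, where C1 accumulates linearly; a rate c strictly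
    above C2 gives a purely geometric bound.  The constant
    M = N x + C1 / (c - C2) satisfies C1 <= (c - C2) M, that is C1 + C2 M <= c M,
    so that each step multiplies the bound by at most c. *)
Lemma iter_affine_growth {R : realFieldType} (T : Type) (N : T -> R)
    (g : T -> T) (C1 C2 c : R) :
  0 <= C1 -> 0 <= C2 -> C2 < c -> 1 <= c ->
  (forall y, N (g y) <= C1 + C2 * N y) ->
  forall x k, 0 <= N x -> N (iter k g x) <= (N x + C1 / (c - C2)) * c ^+ k.
Proof.
move=> C10 C20 C2c c1 gN x k Nx; elim: k => [|k IH].
  by rewrite mulr1 lerDl divr_ge0// subr_ge0 ltW.
rewrite iterS; apply: le_trans (gN _) _.
apply: le_trans (lerD (lexx _) (ler_wpM2l C20 IH)) _.
rewrite exprSr.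
set M := _ + _ / _ in IH *.
have ck : 1 <= c ^+ k by rewrite exprn_ege1.
have cC : 0 < c - C2 by rewrite subr_gt0.
have C1M : C1 <= (c - C2) * M.
  by rewrite /M mulrDr mulrCA divff ?gt_eqF// mulr1 lerDr mulr_ge0// ltW.
have : C1 * 1 <= ((c - C2) * M) * c ^+ k by exact: ler_pM.
move: (c ^+ k) => z; nra.
Qed.

(** * Powers of a normal matrix *)

Lemma diagonalized_expmx {F : fieldType} n (P : 'M[F]_n) (d : 'rV[F]_n) k :
  P \in unitmx ->
  (invmx P *m diag_mx d *m P) ^+ k =
    invmx P *m diag_mx (\row_j d 0 j ^+ k) *m P.
Proof.
move=> Pu; elim: k => [|k IH].
  rewrite expr0 (_ : \row__ _ = const_mx 1).
    by rewrite diag_const_mx mulmx1 mulVmx.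
  by apply/rowP => j; rewrite !mxE.
rewrite exprSr IH -mulmxE !mulmxA (mulmxK Pu) -(mulmxA (invmx P)) mulmx_diag.
by congr (_ *m diag_mx _ *m _); apply/rowP => j; rewrite !mxE exprSr.
Qed.

(** The j-th row of P is a left eigenvector for d_j. *)
Lemma eigenvalue_diagonalized {F : fieldType} n (P : 'M[F]_n) (d : 'rV[F]_n) j :
  P \in unitmx -> eigenvalue (invmx P *m diag_mx d *m P) (d 0 j).
Proof.
move=> Pu; apply/eigenvalueP; exists (row j P).
  rewrite -row_mul !mulmxA mulmxV// mul1mx row_mul row_diag_mx -scalemxAl.
  by rewrite -rowE.
apply/eqP => /(congr1 (mulmx^~ (invmx P))); rewrite -row_mul mulmxV// mul0mx.
by move/rowP/(_ j)/eqP; rewrite !mxE eqxx oner_eq0.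
Qed.

Section SpectralRadius.
Context {R : realType}.
Local Notation toC := (real_complex R).

Lemma normc_ge0 (z : R[i]) : 0 <= Normc.normc z.
Proof. by case: z => a b; exact: sqrtr_ge0. Qed.

Lemma normcX (z : R[i]) k : Normc.normc (z ^+ k) = Normc.normc z ^+ k.
Proof.
by elim: k => [|k IH]; rewrite ?Normc.normc1// !exprS Normc.normcM IH.
Qed.

Lemma normc_real (r : R) : Normc.normc (toC r) = `|r|.
Proof. by rewrite /= expr0n/= addr0 sqrtr_sqr. Qed.

Lemma le_normc_sum (I : Type) (s : seq I) (F : I -> R[i]) :
  Normc.normc (\sum_(i <- s) F i) <= \sum_(i <- s) Normc.normc (F i).
Proof.
elim/big_rec2: _ => [|i y z _ IH]; first by rewrite Normc.normc0.
by apply: le_trans (le_normcD _ _) _; rewrite lerD2l.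
Qed.

(** A supremum bounds its set only if the set is bounded above; here the set is
    finite, since the eigenvalues are the roots of the characteristic
    polynomial, and the sum of the moduli of these roots is an upper bound. *)
Lemma normc_eigenvalue_le m (A : 'M[R]_m) z :
  eigenvalue (map_mx toC A) z -> Normc.normc z <= spectral_radius A.
Proof.
move=> Az; apply: ub_le_sup; last by exists z.
set B := map_mx toC A; have [rs rsE] := closed_field_poly_normal (char_poly B).
exists (\sum_(r <- rs) Normc.normc r) => _ [y /= By <-].
have yrs : y \in rs.
  move: By; rewrite eigenvalue_root_char rsE (monicP (char_poly_monic _)).
  by rewrite scale1r root_prod_XsubC.
by rewrite (big_rem y)//= lerDl sumr_ge0// => r _; exact: normc_ge0.
Qed.

Lemma normal_mx_complex m (A : 'M[R]_m) :
  normal_mx A -> map_mx toC A \is normalmx.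
Proof.
move=> An; apply/normalmxP.
rewrite (_ : map_mx _ (map_mx toC A)^T = map_mx toC A^T); last first.
  by apply/matrixP => i j; rewrite !mxE; exact: conjc_real.
by rewrite -!map_mxM An.
Qed.

(** If A = P^-1 D P with D diagonal, then A^k = P^-1 D^k P and the entry (i, j)
    of A^k is the sum over l of (P^-1)_il d_l^k P_lj, where |d_l| <= rho.
    Normality is what provides the diagonalization.  The Euclidean operator
    norm would give the constant 1, but any constant is enough for the
    convergence of the series. *)
Lemma normal_mx_power_bound m (A : 'M[R]_m) : (0 < m)%N -> normal_mx A ->
  0 <= spectral_radius A /\
  exists2 K : R, 0 <= K & forall k, `|A ^+ k| <= K * spectral_radius A ^+ k.
Proof.
move=> m0 An; set rho := spectral_radius A.
have /orthomx_spectralP := normal_mx_complex An.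
set P := spectralmx _; set d := spectral_diag _ => AE.
have Pu : P \in unitmx by exact: spectral_unit.
have d_rho j : Normc.normc (d 0 j) <= rho.
  by apply: normc_eigenvalue_le; rewrite AE; exact: eigenvalue_diagonalized.
have rho0 : 0 <= rho := le_trans (normc_ge0 _) (d_rho (Ordinal m0)).
split=> //.
pose K := \sum_i \sum_j \sum_l Normc.normc (invmx P i l) * Normc.normc (P l j).
have K_ge0 i j : 0 <= \sum_l Normc.normc (invmx P i l) * Normc.normc (P l j).
  by apply: sumr_ge0 => l _; rewrite mulr_ge0// normc_ge0.
have K0 : 0 <= K by do 2!apply: sumr_ge0 => ? _.
exists K => // k; apply: mx_norm_le => [|i j].
  by rewrite mulr_ge0// exprn_ge0.
have -> : `|(A ^+ k) i j| = Normc.normc (((map_mx toC A) ^+ k) i j).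
  rewrite -normc_real; congr Normc.normc.
  suff <- : map_mx toC (A ^+ k) = map_mx toC A ^+ k by rewrite !mxE.
  by elim: k => [|k IH]; rewrite ?map_mx1// !exprS -!mulmxE map_mxM IH.
rewrite AE diagonalized_expmx// mul_mx_diag mxE.
apply: le_trans (le_normc_sum _ _) _.
apply: (@le_trans _ _
    ((\sum_l Normc.normc (invmx P i l) * Normc.normc (P l j)) * rho ^+ k)).
  rewrite mulr_suml ler_sum// => l _; rewrite !mxE !Normc.normcM normcX mulrAC.
  by rewrite ler_wpM2l ?mulr_ge0 ?normc_ge0// lerXn2r ?nnegrE ?normc_ge0.
rewrite ler_wpM2r ?exprn_ge0// /K [leRHS](bigD1 i)//=.
rewrite [X in _ <= X + _](bigD1 j)//= -addrA lerDl.
by rewrite addr_ge0// !sumr_ge0// => ? _; rewrite ?sumr_ge0.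
Qed.

End SpectralRadius.

(** * The terms of the series *)

(** The product rho c is nondecreasing in c and lies below 1 at c = max (1, C2);
    as rho < 1, moving c up by (1 - rho max (1, C2)) / 2 keeps it below 1.  When
    C2 = 0 the second bound on rho is infinite and only rho < 1 remains. *)
Lemma growth_rate_between {R : realType} (rho C2 : R) :
  0 <= rho -> 0 <= C2 -> (rho%:E < mine 1 (1 / C2%:E))%E ->
  exists c : R, [/\ 1 <= c, C2 < c & rho * c < 1].
Proof.
move=> rho0 C20; rewrite lt_min lte_fin => /andP[rho1 rhoC2].
have {rhoC2} rhoC2 : rho * C2 < 1.
  have [->|C2N0] := eqVneq C2 0; first by rewrite mulr0.
  have C2gt0 : 0 < C2 by rewrite lt_neqAle eq_sym C2N0.
  by move: rhoC2; rewrite inver (negbTE C2N0) mul1e lte_fin -div1r ltr_pdivlMr.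
pose M := Num.max 1 C2.
have M1 : 1 <= M by rewrite le_max lexx.
have MC2 : C2 <= M by rewrite le_max lexx orbT.
have rhoM : rho * M < 1 by rewrite /M maxEle; case: ifP => _; rewrite ?mulr1.
exists (M + (1 - rho * M) / 2); split; [lra|lra|nra].
Qed.

(** The decay rho^i of A^i beats the growth c^i.+1 of the backward orbit.  The
    constant L is uniform over the ball of radius r, as the M-test requires. *)
Lemma T_term_geometric_bound {R : realType} n p m
    (finv : 'cV[R]_n -> 'cV[R]_n) (h : 'cV[R]_n -> 'cV[R]_p)
    (A : 'M[R]_m) (B : 'M[R]_(m, p)) (C1 C2 C1' C2' c K rho : R) :
  0 <= C1 -> 0 <= C2 -> 0 <= C1' -> 0 <= C2' -> C2 < c -> 1 <= c ->
  (forall y, enorm (finv y) <= C1 + C2 * enorm y) ->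
  (forall y, enorm (h y) <= C1' + C2' * enorm y) ->
  0 <= K -> 0 <= rho -> (forall k, `|A ^+ k| <= K * rho ^+ k) ->
  forall r, exists L, forall x, enorm x <= r -> forall i,
    `|T_term finv h A B x i| <= geometric L (rho * c) i.
Proof.
move=> C10 C20 C1'0 C2'0 C2c c1 finv_bound h_bound K0 rho0 A_bound r.
pose D := r + C1 / (c - C2).
exists (p%:R * (m%:R * K * `|B|) * ((C1' + C2' * D) * c)) => x xr i.
have D0 : 0 <= D.
  by rewrite addr_ge0 ?divr_ge0 ?subr_ge0 ?(ltW C2c)// (le_trans (enorm_ge0 x)).
have c0 : 0 <= c by exact: le_trans c1.
have h_iter : `|h (iter i.+1 finv x)| <= (C1' + C2' * D) * c ^+ i.+1.
  apply: le_trans (norm_le_enorm _) _; apply: le_trans (h_bound _) _.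
  rewrite mulrDl lerD//; first by rewrite ler_peMr// exprn_ege1.
  rewrite -mulrA ler_wpM2l//.
  have := iter_affine_growth C10 C20 C2c c1 finv_bound i.+1 (enorm_ge0 x).
  move=> /le_trans; apply.
  by rewrite ler_wpM2r ?exprn_ge0// lerD2r.
have AB : `|A ^+ i *m B| <= m%:R * K * `|B| * rho ^+ i.
  apply: le_trans (mulmx_norm_le _ _) _.
  by rewrite [leRHS]mulrAC ler_wpM2r// -mulrA ler_wpM2l.
apply: le_trans (mulmx_norm_le _ _) _.
apply: (@le_trans _ _ (p%:R * (m%:R * K * `|B| * rho ^+ i) *
    ((C1' + C2' * D) * c ^+ i.+1))).
  by apply: ler_pM => //; rewrite ?mulr_ge0// ler_wpM2l.
by rewrite /geometric /= exprS exprMn le_eqVlt; apply/orP; left;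
  apply/eqP; ring.
Qed.

Lemma T_term_continuous {R : realType} n p m (finv : 'cV[R]_n -> 'cV[R]_n)
    (h : 'cV[R]_n -> 'cV[R]_p) (A : 'M[R]_m) (B : 'M[R]_(m, p)) i :
  continuous finv -> continuous h -> continuous (T_term finv h A B ^~ i).
Proof.
move=> finv_cont h_cont x.
have iter_cont k : continuous (iter k finv).
  elim: k => [|k IH] y; first exact: cvg_id.
  exact: (continuous_comp (IH y) (finv_cont _)).
have hi := continuous_comp (iter_cont i.+1 x) (h_cont _).
exact: (continuous_comp hi (@mulmx_continuous _ _ _ _ _ _)).
Qed.

(** The backward orbit of f x is that of x preceded by x itself, so the series
    at f x is the one at x multiplied by A, plus a new first term. *)
Lemma series_T_termS {R : realType} n p m (f finv : 'cV[R]_n -> 'cV[R]_n)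
    (h : 'cV[R]_n -> 'cV[R]_p) (A : 'M[R]_m) (B : 'M[R]_(m, p)) x k :
  cancel f finv ->
  series (T_term finv h A B (f x)) k.+1 =
    A *m series (T_term finv h A B x) k + B *m h x.
Proof.
move=> fK; rewrite /series /= big_nat_recl//= addrC mulmx_sumr.
rewrite {2}/T_term /= fK expr0 mul1mx; congr (_ + _).
by apply: eq_bigr => i _; rewrite /T_term iterSr fK exprS -mulmxE !mulmxA.
Qed.

(** * The theorem *)

Theorem theorem2 (R : realType) (n p : nat) (n_gt0 : (0 < n)%N)
    (p_gt0 : (0 < p)%N)
    (f finv : 'cV[R]_n -> 'cV[R]_n) (h : 'cV[R]_n -> 'cV[R]_p)
    (X : set 'cV[R]_n)
    (fK : cancel f finv) (finvK : cancel finv f)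
    (finv_cont : continuous finv) (h_cont : continuous h)
    (C1 C2 C1' C2' : R)
    (C1_ge0 : 0 <= C1) (C2_ge0 : 0 <= C2)
    (C1'_ge0 : 0 <= C1') (C2'_ge0 : 0 <= C2')
    (f_bound : forall x : 'cV[R]_n, enorm x <= C1 + C2 * enorm (f x))
    (h_bound : forall x : 'cV[R]_n, enorm (h x) <= C1' + C2' * enorm x)
    (m : nat) (m_gt0 : (0 < m)%N)
    (A : 'M[R]_m) (A_normal : normal_mx A)
    (A_radius : ((spectral_radius A)%:E < mine 1 (1 / C2%:E))%E)
    (B : 'M[R]_(m, p)) :
  [/\ (forall x, X x ->
         cvgn (series (T_term finv h A B x))),
      {within X, continuous (T_map finv h A B)} &
      (forall x, X x ->
         cvgn (series (T_term finv h A B (f x))) /\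
         T_map finv h A B (f x) = A *m T_map finv h A B x + B *m h x)].
Proof.
have [rho0 [K K0 A_bound]] := normal_mx_power_bound m_gt0 A_normal.
have [c [c1 C2c rhoc1]] := growth_rate_between rho0 C2_ge0 A_radius.
have finv_bound y : enorm (finv y) <= C1 + C2 * enorm y.
  by rewrite -{2}(finvK y).
have geo L : cvgn (series (geometric L (spectral_radius A * c))).
  apply: is_cvg_geometric_series; rewrite ger0_norm// mulr_ge0//.
  exact: le_trans c1.
have T_bound := T_term_geometric_bound B C1_ge0 C2_ge0 C1'_ge0 C2'_ge0 C2c c1
  finv_bound h_bound K0 rho0 A_bound.
have T_cvg x : cvgn (series (T_term finv h A B x)).
  have [L xL] := T_bound (enorm x).
  exact: dominated_series_cvg (xL x (lexx _)) (geo L).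
split=> [x _| |x _]; first exact: T_cvg.
  apply: continuous_subspaceT.
  apply: locally_dominated_series_continuous => [i|x].
    exact: T_term_continuous.
  (* Points y near x satisfy |y| <= |x| + 1 in the maximum norm. *)
  have [L xL] := T_bound (Num.sqrt n%:R * (`|x| + 1)).
  exists (geometric L (spectral_radius A * c)) => //.
  near=> y => i; apply: xL; apply: le_trans (enorm_le_norm y) _.
  rewrite ler_wpM2l// -[y](subrK x) addrC (le_trans (ler_normD _ _))// lerD2l.
  by rewrite distrC; near: y; move/cvgrPdist_le : (@cvg_id _ (nbhs x)); apply.
split; first exact: T_cvg.
apply: (cvg_lim (@norm_hausdorff _ _)); rewrite -cvg_shiftS.
under eq_fun do rewrite (series_T_termS _ _ _ _ _ fK).
apply: cvgD; last exact: cvg_cst.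
exact: (cvg_comp _ _ (T_cvg x) (@mulmx_continuous _ _ _ _ _ _)).
Unshelve. all: by end_near. Qed.
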